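(* Let $\mathcal{H}$ be a complex Hilbert space and let $E\in\mathcal{B}(\mathcal{H})$ satisfy $E^{2}=E$, written with respect to $\mathcal{H}=R(E)\oplus R(E)^{\perp}$ as $$E=\begin{pmatrix}I&E_1\\ 0&0\end{pmatrix},\qquad E_1\in\mathcal{B}(R(E)^{\perp},R(E)).$$ Let $J\in\mathcal{B}(\mathcal{H})$ be a symmetry. Then $E$ is a $J$-projection if and only if $J$ has, with respect to $R(E)\oplus R(E)^{\perp}$, the operator matrix form $$J=\begin{pmatrix}J_1(I+E_1E_1^{*})^{-\frac12}&J_1(I+E_1E_1^{*})^{-\frac12}E_1\\ E_1^{*}(I+E_1E_1^{*})^{-\frac12}J_1&J_2(I+E_1^{*}E_1)^{-\frac12}\end{pmatrix},$$ where $J_1$ and $J_2$ are symmetries on the subspaces $R(E)$ and $R(E)^{\perp}$ respectively, satisfying $J_1E_1+E_1J_2=0$.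
   Context: A bounded operator $J$ is a symmetry if $J=J^{*}=J^{-1}$. An idempotent $E$ is called a $J$-projection if $E=JE^{*}J$. $R(E)$ denotes the range of $E$ (closed, since $E$ is a bounded idempotent). *)

(* Defs.v *)
From HB Require Import structures.
From mathcomp Require Import all_boot all_order all_algebra.
From mathcomp Require Import sesquilinear ring.
From mathcomp Require Import boolp classical_sets reals topology normedtype.

Set Implicit Arguments.
Unset Strict Implicit.
Unset Printing Implicit Defensive.

Import Order.TTheory GRing.Theory Num.Theory Num.Def.
Import numFieldNormedType.Exports.

Local Open Scope classical_set_scope.
Local Open Scope ring_scope.

(* The scalars are an arbitrary [numClosedFieldType] so that the generic theory  *)
(* applies; the complex Hilbert spaces are the types [hilbertType R[i]] with     *)
(* [R : realType]. The inner product is linear in its first argument.            *)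
HB.mixin Record CompleteNormedModule_isHilbert (C : numClosedFieldType) H
    & CompleteNormedModule C H := {
  inner : {dot H for conjC};
  inner_norm : forall x : H, `|x| ^+ 2 = inner x x
}.

#[short(type="hilbertType")]
HB.structure Definition Hilbert (C : numClosedFieldType) :=
  {H of CompleteNormedModule C H & CompleteNormedModule_isHilbert C H}.

Notation "''[' x , y ]" := (inner x y) : ring_scope.

Section InnerTheory.
Variables (C : numClosedFieldType) (H : hilbertType C).
Implicit Types x y z : H.

Lemma inner_self_ge0 x : 0 <= '[x, x].
Proof. exact: dnorm_ge0. Qed.

Lemma inner_cauchy_schwarz x y : `|'[x, y]| <= `|x| * `|y|.
Proof.
have [->|y0] := eqVneq y 0; first by rewrite linear0r normr0 mulr_ge0.
have yy0 : 0 < '[y, y] by exact: neq0_dnorm_gt0.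
rewrite -ler_sqr ?nnegrE ?mulr_ge0// exprMn !inner_norm -ler_pdivrMr//.
rewrite -subr_ge0; set a := '[x, y] / '[y, y].
suff -> : '[x, x] - `|'[x, y]| ^+ 2 / '[y, y] = '[x - a *: y, x - a *: y].
  exact: inner_self_ge0.
have yyE : conjC '[y, y] = '[y, y].
  by apply/CrealP; exact: ger0_real (inner_self_ge0 y).
have yxE : '[y, x] = conjC '[x, y] by rewrite hermC expr0 mul1r.
rewrite linearBl/= !linearBr/= !linearZl_LR/= !linearZr_LR/= yxE.
rewrite /a rmorphM/= fmorphV/= yyE normCK.
by field; rewrite gt_eqF.
Qed.

End InnerTheory.

(* A closed subspace is regarded as a Hilbert space in its own right, with the   *)
(* restricted inner product, through the coercion [hilbert_of_subspace].         *)
Record closedSubspace (C : numClosedFieldType) (H : hilbertType C) :=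
  ClosedSubspace {
    cs_set : set H;
    cs_submod : GRing.submod_closed (mem cs_set);
    cs_closed : closed cs_set
  }.

Section SubspaceHilbert.
Variables (C : numClosedFieldType) (H : hilbertType C) (M : closedSubspace H).

Record subspace_of := SubspaceOf {
  subspace_val : H;
  _ : subspace_val \in cs_set M
}.

HB.instance Definition _ := [isSub for subspace_val].
HB.instance Definition _ := [Choice of subspace_of by <:].
HB.instance Definition _ :=
  GRing.SubChoice_isSubLmodule.Build C H _ subspace_of (cs_submod M).

Let sub_norm (x : subspace_of) : C := `|val x|.

Let sub_ler_normD x y : sub_norm (x + y) <= sub_norm x + sub_norm y.
Proof. by rewrite /sub_norm raddfD ler_normD. Qed.

Let sub_normrZ (a : C) x : sub_norm (a *: x) = `|a| * sub_norm x.
Proof. by rewrite /sub_norm linearZ/= normrZ. Qed.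

Let sub_normr0_eq0 x : sub_norm x = 0 -> x = 0.
Proof.
by move/eqP; rewrite normr_eq0 => /eqP x0; apply: val_inj; rewrite x0 raddf0.
Qed.

HB.instance Definition _ := @Lmodule_isNormed.Build C subspace_of
  sub_norm sub_ler_normD sub_normrZ sub_normr0_eq0.

Lemma sub_normE (x : subspace_of) : `|x| = `|val x|.
Proof. by []. Qed.

Let sub_complete (F : set_system subspace_of) :
  ProperFilter F -> cauchy F -> cvg F.
Proof.
move=> FF /cauchy_ballP Fc.
have Gc : cauchy (val @ F : set_system H).
  apply/cauchy_ballP => e e0; have [[A B] /= [FA FB] AB] := Fc e e0.
  exists (val @` A, val @` B) => /=.
    by split; [apply: filterS FA|apply: filterS FB] => x ?; exists x.
  move=> [_ _] /= [[x Ax <-] [y By <-]]; have := AB (x, y) (conj Ax By).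
  by rewrite -!ball_normE /= sub_normE raddfB.
have [l Gl] : exists l : H, val @ F --> l.
  by apply/cvg_ex; exact: cauchy_cvg.
have Ml : l \in cs_set M.
  rewrite inE; apply: (closed_cvg (cs_set M) _ _ _ Gl).
  - exact: cs_closed.
  - by apply: nearW => x; have := valP x; rewrite inE.
apply/cvg_ex; exists (SubspaceOf Ml); apply/cvgrPdist_lt => e e0.
move/cvgrPdist_lt : Gl => /(_ e e0); apply: filterS => x.
by rewrite sub_normE raddfB.
Qed.

HB.instance Definition _ := Uniform_isComplete.Build subspace_of sub_complete.

Definition sub_inner (x y : subspace_of) : C := '[val x, val y].

Let sub_inner_bilinear : bilinear_for *%R (conjC \; *%R) sub_inner.
Proof.
split=> [y a x1 x2|x a y1 y2]; rewrite /sub_inner linearP.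
- by rewrite linearDl linearZl_LR.
- by [].
Qed.

HB.instance Definition _ :=
  bilinear_isBilinear.Build C _ _ _ _ _ sub_inner sub_inner_bilinear.

Let sub_inner_hermitian x y :
  sub_inner x y = (-1) ^+ false * conjC (sub_inner y x).
Proof. exact: hermC. Qed.

HB.instance Definition _ :=
  isHermitianSesquilinear.Build C _ _ _ sub_inner sub_inner_hermitian.

Let sub_inner_gt0 x : x != 0 -> 0 < sub_inner x x.
Proof.
move=> x0; apply: neq0_dnorm_gt0; apply: contra_neq x0 => x0.
by apply: val_inj; rewrite x0 raddf0.
Qed.

HB.instance Definition _ := isDotProduct.Build C _ sub_inner sub_inner_gt0.

Let sub_inner_norm x : `|x| ^+ 2 = sub_inner x x.
Proof. exact: inner_norm. Qed.

HB.instance Definition _ :=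
  CompleteNormedModule_isHilbert.Build C subspace_of sub_inner_norm.

Definition hilbert_of_subspace : hilbertType C := subspace_of.

End SubspaceHilbert.

Coercion hilbert_of_subspace : closedSubspace >-> Hilbert.type.


Section BoundedOperators.
Variable C : numClosedFieldType.
Implicit Types H K L : hilbertType C.

Record bop H K := Bop {
  bop_fun :> {linear H -> K};
  bop_bounded : bounded_near bop_fun (nbhs (0 : H))
}.

Lemma bop_continuous H K (T : bop H K) : continuous T.
Proof. exact/linear_bounded_continuous/bop_bounded. Qed.

Definition bop_of_continuous H K (f : {linear H -> K}) (cf : continuous f) :
  bop H K := Bop (proj2 (linear_bounded_continuous f) cf).

Lemma bop_eqP H K (S T : bop H K) : S =1 T -> S = T.
Proof.
case: S T => [S bS] [T bT] /= /funext ST.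
have E : S = T.
  case: S T {bS bT} ST => [S [[cS1] [cS2]]] [T [[cT1] [cT2]]] /= ST.
  case: _ / ST in cT1 cT2 *.
  by rewrite (Prop_irrelevance cS1 cT1) (Prop_irrelevance cS2 cT2).
by case: _ / E in bT *; rewrite (Prop_irrelevance bS bT).
Qed.

Let id_continuous H : continuous (idfun : H -> H).
Proof. by move=> x; exact: cvg_id. Qed.

Definition bop_id H : bop H H := bop_of_continuous (@id_continuous H).

Let comp_continuous H K L (S : bop K L) (T : bop H K) : continuous (S \o T).
Proof.
by move=> x; apply: continuous_comp; exact: bop_continuous.
Qed.

Definition bop_comp H K L (S : bop K L) (T : bop H K) : bop H L :=
  bop_of_continuous (@comp_continuous H K L S T).

Let zero_continuous H K : continuous (\0 : H -> K).
Proof. by move=> x; exact: cvg_cst. Qed.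

Definition bop_zero H K : bop H K := bop_of_continuous (@zero_continuous H K).

Let add_continuous H K (S T : bop H K) : continuous (S \+ T).
Proof. by move=> x; apply: cvgD; exact: bop_continuous. Qed.

Definition bop_add H K (S T : bop H K) : bop H K :=
  bop_of_continuous (@add_continuous H K S T).

Let opp_continuous H K (T : bop H K) : continuous (\- T).
Proof. by move=> x; apply: cvgN; exact: bop_continuous. Qed.

Definition bop_opp H K (T : bop H K) : bop H K :=
  bop_of_continuous (@opp_continuous H K T).

Section Zmodule.
Variables H K : hilbertType C.

HB.instance Definition _ := gen_eqMixin (bop H K).
HB.instance Definition _ := gen_choiceMixin (bop H K).

Let bop_addA : associative (@bop_add H K).
Proof. by move=> S T U; apply: bop_eqP => x; exact: addrA. Qed.

Let bop_addC : commutative (@bop_add H K).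
Proof. by move=> S T; apply: bop_eqP => x; exact: addrC. Qed.

Let bop_add0 : left_id (bop_zero H K) (@bop_add H K).
Proof. by move=> T; apply: bop_eqP => x; exact: add0r. Qed.

Let bop_addN : left_inverse (bop_zero H K) (@bop_opp H K) (@bop_add H K).
Proof. by move=> T; apply: bop_eqP => x; exact: addNr. Qed.

HB.instance Definition _ :=
  GRing.isZmodule.Build (bop H K) bop_addA bop_addC bop_add0 bop_addN.

End Zmodule.
End BoundedOperators.

Notation "''B' ( H , K )" := (bop H K)
  (at level 8, format "''B' ( H ,  K )") : type_scope.
Notation "''B' ( H )" := (bop H H)
  (at level 8, format "''B' ( H )") : type_scope.
Notation "S ** T" := (bop_comp S T) (at level 40, left associativity) : ring_scope.

Section Operators.
Variable C : numClosedFieldType.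
Implicit Types H K : hilbertType C.

(* [adj], [bop_inv] and [bop_sqrt] pick, by classical choice, the operator with *)
(* the defining property, and are [0] when there is none. Over [R[i]] the        *)
(* adjoint of every bounded operator exists (Riesz), as does the positive square *)
(* root of every positive operator; both are unique, as is an inverse.           *)
Definition adj H K (T : 'B(H, K)) : 'B(K, H) :=
  xget 0 [set S : 'B(K, H) | forall x y, '[T x, y] = '[x, S y]].

Lemma adj_unique H K (T : 'B(H, K)) (S : 'B(K, H)) :
  (forall x y, '[T x, y] = '[x, S y]) -> adj T = S.
Proof.
move=> TS; rewrite /adj; case: xgetP => [S' _ TS'|/(_ S)//].
apply: bop_eqP => y; apply/eqP; rewrite -subr_eq0 -(dnorm_eq0 inner) linearBr/=.
by rewrite -TS' -TS subrr.
Qed.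

Definition inverse_of H (T S : 'B(H)) := S ** T = bop_id H /\ T ** S = bop_id H.

Definition bop_inv H (T : 'B(H)) : 'B(H) := xget 0 [set S | inverse_of T S].

Definition positive_op H (T : 'B(H)) := forall x, 0 <= '[T x, x].

Definition bop_sqrt H (T : 'B(H)) : 'B(H) :=
  xget 0 [set S | positive_op S /\ S ** S = T].

(* T^(-1/2) *)
Definition bop_invsqrt H (T : 'B(H)) : 'B(H) := bop_inv (bop_sqrt T).

Definition is_symmetry H (J : 'B(H)) := J = adj J /\ inverse_of J J.

Definition is_idempotent H (E : 'B(H)) := E ** E = E.

Definition J_projection H (J E : 'B(H)) := is_idempotent E /\ E = J ** adj E ** J.

End Operators.

Section Subspaces.
Variables (C : numClosedFieldType) (H : hilbertType C).

Definition orth_set (A : set H) : set H :=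
  [set x | forall y, A y -> '[x, y] = 0].

Let orth_submod A : GRing.submod_closed (mem (orth_set A)).
Proof.
split; first by rewrite inE => y _; exact: linear0l.
move=> a x y /[!inE] Ax Ay z Az.
by rewrite linearDl linearZl_LR /= Ax// Ay// mulr0 addr0.
Qed.

Let orth_closed A : closed (orth_set A).
Proof.
move=> x clx y Ay; apply/eqP/negPn/negP => xy0.
have y0 : 0 < `|y|.
  by rewrite normr_gt0; apply: contra_neq xy0 => ->; exact: linear0r.
have e0 : 0 < `|'[x, y]| / `|y| by apply: divr_gt0 => //; rewrite normr_gt0.
have [z [Az]] := clx _ (nbhsx_ballx x _ e0).
rewrite -ball_normE /= ltr_pdivlMr// => /lt_geF/negP; apply.
by rewrite (le_trans _ (inner_cauchy_schwarz _ _))// linearBl/= (Az y)// subr0.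
Qed.

Definition orth (M : closedSubspace H) : closedSubspace H :=
  ClosedSubspace (@orth_submod (cs_set M)) (@orth_closed (cs_set M)).

Section Range.
Variables (E : 'B(H)) (idemE : is_idempotent E).

Let range_fix : range E = [set x | x - E x = 0].
Proof.
apply/seteqP; split => [_ [x _ <-]|x] /=.
  by rewrite -[E (E x)]/((E ** E) x) idemE subrr.
by move/eqP; rewrite subr_eq0 => /eqP xE; exists x.
Qed.

Let range_submod : GRing.submod_closed (mem (range E)).
Proof.
split; first by rewrite inE; exists 0 => //; rewrite linear0.
move=> a _ _ /[!inE] -[x _ <-] [y _ <-]; exists (a *: x + y) => //.
by rewrite linearP.
Qed.

Let range_closed : closed (range E).
Proof.
rewrite range_fix; apply: (@preimage_closed _ _ (fun x => x - E x) [set 0]).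
  by move=> x _; apply: cvgB; [exact: cvg_id|exact: bop_continuous].
exact/accessible_closed_set1/hausdorff_accessible/norm_hausdorff.
Qed.

Definition ran : closedSubspace H := ClosedSubspace range_submod range_closed.

End Range.

(* T = [[A11, A12], [A21, A22]] with respect to M (+) M^perp: every vector of    *)
(* [H] is uniquely [u + v] with [u] in [M] and [v] in its orthogonal complement. *)
Definition has_block_matrix (M : closedSubspace H) (T : 'B(H))
    (A11 : 'B(M)) (A12 : 'B(orth M, M)) (A21 : 'B(M, orth M))
    (A22 : 'B(orth M)) :=
  forall (u : M) (v : orth M),
    T (subspace_val u + subspace_val v) =
    subspace_val (A11 u + A12 v) + subspace_val (A21 u + A22 v).

End Subspaces.

(* Main.v *)
(* Write J = [[A, B], [C, D]] with A, D self-adjoint and C = B^*. For a symmetry  *)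
(* J, E = J E^* J amounts to B = A E1. Then J^2 = I reads A (I + E1 E1^* ) A = I,  *)
(* A E1 = - E1 D and D (I + E1^* E1) D = I, so that A and D commute with           *)
(* I + E1 E1^* and I + E1^* E1, and J1 = A (I + E1 E1^* )^(1/2) and                *)
(* J2 = D (I + E1^* E1)^(1/2) are symmetries. The remaining identities follow      *)
(* from the fact that P X = X Q implies P^(1/2) X = X Q^(1/2).                     *)
From HB Require Import structures.
Require Import Defs.
From mathcomp Require Import all_boot all_order all_algebra.
From mathcomp Require Import complex reals.
From mathcomp Require Import sesquilinear ring lra.
From mathcomp Require Import boolp classical_sets topology normedtype sequences.

Set Implicit Arguments.
Unset Strict Implicit.
Unset Printing Implicit Defensive.

Import Order.TTheory GRing.Theory Num.Theory Num.Def.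
Import numFieldNormedType.Exports.

Local Open Scope ring_scope.
Local Open Scope complex_scope.

(** * The real inner product of a complex Hilbert space *)

Section RealStructure.
Variables (R : realType) (H : hilbertType R[i]).
Implicit Types (x y z : H) (t : R).

Definition rnorm x : R := complex.Re `|x|.
Definition rdot x y : R := complex.Re '[x, y].

Lemma normE x : `|x| = (rnorm x)%:C.
Proof. by rewrite RRe_real ?normr_real. Qed.

Lemma rnorm_ge0 x : 0 <= rnorm x.
Proof. by rewrite -ler0c -normE. Qed.

Lemma rnorm0 : rnorm 0 = 0.
Proof. by rewrite /rnorm normr0. Qed.

Lemma rnorm0_eq0 x : rnorm x = 0 -> x = 0.
Proof. by move=> x0; apply/eqP; rewrite -normr_eq0 normE x0. Qed.

Lemma rnorm_gt0 x : x != 0 -> 0 < rnorm x.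
Proof.
by move=> x0; rewrite lt_def rnorm_ge0 andbT; apply: contra_neq x0; exact: rnorm0_eq0.
Qed.

Lemma ler_rnormD x y : rnorm (x + y) <= rnorm x + rnorm y.
Proof. by rewrite -lecR rmorphD /= -!normE ler_normD. Qed.

Lemma rnormN x : rnorm (- x) = rnorm x.
Proof. by rewrite /rnorm normrN. Qed.

Lemma rdistC x y : rnorm (x - y) = rnorm (y - x).
Proof. by rewrite -rnormN opprB. Qed.

Lemma rdist_triangle z x y : rnorm (x - y) <= rnorm (x - z) + rnorm (z - y).
Proof. by rewrite -[x in X in X <= _](subrK z) -addrA ler_rnormD. Qed.

Lemma rnormZ t x : rnorm (t%:C *: x) = `|t| * rnorm x.
Proof.
apply: complexI; rewrite rmorphM /= -!normE normrZ.
by rewrite normc_def /= expr0n addr0 sqrtr_sqr.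
Qed.

Lemma rnormZc (a : R[i]) x : rnorm (a *: x) = complex.Re `|a| * rnorm x.
Proof. by apply: complexI; rewrite rmorphM /= -!normE normrZ. Qed.

Lemma rnorm_sqr x : rnorm x ^+ 2 = rdot x x.
Proof. by apply: complexI; rewrite /rdot -inner_norm !normE -!rmorphXn. Qed.

Lemma innerC x y : '[x, y] = conjC '[y, x].
Proof. by rewrite hermC expr0 mul1r. Qed.

Lemma rdotC x y : rdot x y = rdot y x.
Proof. by rewrite /rdot innerC; case: '[y, x]. Qed.

Lemma rdotDl x y z : rdot (x + y) z = rdot x z + rdot y z.
Proof. by rewrite /rdot linearDl raddfD. Qed.

Lemma rdotNl x z : rdot (- x) z = - rdot x z.
Proof. by rewrite /rdot linearNl raddfN. Qed.

Lemma rdotBl x y z : rdot (x - y) z = rdot x z - rdot y z.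
Proof. by rewrite rdotDl rdotNl. Qed.

Lemma rdotZl t x z : rdot (t%:C *: x) z = t * rdot x z.
Proof. by rewrite /rdot linearZl_LR /=; case: '[x, z] => a b /=; ring. Qed.

Lemma rdot_iZ x z : rdot ((0 +i* 1) *: x) z = - complex.Im '[x, z].
Proof. by rewrite /rdot linearZl_LR /=; case: '[x, z] => a b /=; ring. Qed.

Lemma rdotDr x y z : rdot x (y + z) = rdot x y + rdot x z.
Proof. by rewrite rdotC rdotDl !(rdotC _ x). Qed.

Lemma rdotNr x z : rdot x (- z) = - rdot x z.
Proof. by rewrite rdotC rdotNl rdotC. Qed.

Lemma rdotBr x y z : rdot x (y - z) = rdot x y - rdot x z.
Proof. by rewrite rdotDr rdotNr. Qed.

Lemma rdotZr t x z : rdot x (t%:C *: z) = t * rdot x z.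
Proof. by rewrite rdotC rdotZl rdotC. Qed.

Lemma rdot0l x : rdot 0 x = 0.
Proof. by rewrite /rdot linear0l. Qed.

Lemma rdot0r x : rdot x 0 = 0.
Proof. by rewrite rdotC rdot0l. Qed.

Lemma rdot_conjZ (a : R[i]) x y : rdot x (a *: y) = rdot (conjC a *: x) y.
Proof. by rewrite /rdot linearZr_LR linearZl_LR. Qed.

Lemma rdot_le x y : `|rdot x y| <= rnorm x * rnorm y.
Proof.
rewrite -lecR rmorphM /= -!normE; apply: le_trans (inner_cauchy_schwarz x y).
exact: normc_ge_Re.
Qed.

Lemma rdot_nondeg x y : (forall z, rdot z x = rdot z y) -> x = y.
Proof.
move=> xy; apply/eqP; rewrite -subr_eq0; apply/eqP/rnorm0_eq0/eqP.
by rewrite -sqrf_eq0 rnorm_sqr rdotBr xy subrr.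
Qed.

Lemma rnormB_sqr x y t :
  rnorm (x - t%:C *: y) ^+ 2 =
  rnorm x ^+ 2 - t *+ 2 * rdot x y + t ^+ 2 * rnorm y ^+ 2.
Proof.
rewrite !rnorm_sqr rdotBl !rdotBr !rdotZl !rdotZr (rdotC y x); ring.
Qed.

Lemma parallelogram x y :
  rnorm (x + y) ^+ 2 + rnorm (x - y) ^+ 2 = (rnorm x ^+ 2 + rnorm y ^+ 2) *+ 2.
Proof. by rewrite !rnorm_sqr rdotBl rdotDl !rdotBr !rdotDr; ring. Qed.

End RealStructure.

Section RealInner.
Variables (R : realType) (H K : hilbertType R[i]).


Lemma inner_rdot (x y : H) (z w : K) : rdot x y = rdot z w ->
  rdot ((0 +i* 1) *: x) y = rdot ((0 +i* 1) *: z) w -> '[x, y] = '[z, w].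
Proof.
move=> re im; apply/eqP; rewrite eq_complex; apply/andP.
by split; apply/eqP => //; apply: oppr_inj; rewrite -!rdot_iZ.
Qed.

End RealInner.

Section Completeness.
Variables (R : realType) (H : hilbertType R[i]).

Lemma cauchy_seq_cvg (u : nat -> H) (d : nat -> R) :
  (forall e, 0 < e -> exists n, d n < e) ->
  (forall n m, (n <= m)%N -> rnorm (u m - u n) <= d n) ->
  exists l, forall n, rnorm (u n - l) <= d n.
Proof.
move=> d0 ud.
have [l ul] : exists l : H, (u @ \oo --> l)%classic.
  apply/cvg_ex; apply: cauchy_cvg; apply/cauchy_ballP => e e0.
  have [e' e'0 eE] : exists2 t, 0 < t & e = t%:C.
    exists (complex.Re e); first by move: e0; rewrite ltcE => /andP[].
    by rewrite RRe_real ?gtr0_real.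
  have [n dn] := d0 _ (divr_gt0 e'0 (@ltr0n R 2)).
  pose tail : set H := [set u m | m in [set m | (n <= m)%N]]%classic.
  exists (tail, tail).
    by split; exists n => // m /= nm; exists m.
  move=> [_ _] [/= [p np <-] [q nq <-]].
  rewrite -ball_normE /= normE eE ltcR.
  apply: le_lt_trans (rdist_triangle (u n) _ _) _.
  by rewrite [rnorm (u n - _)]rdistC; have := ud _ _ np; have := ud _ _ nq; lra.
exists l => n; apply/ler_addgt0Pl => e e0.
have /cvgrPdist_lt/(_ e%:C) := ul; rewrite ltcR => /(_ e0) [N _ Nl].
apply: le_trans (rdist_triangle (u (maxn n N)) _ _) _.
rewrite rdistC addrC lerD ?ud ?leq_maxl//.
have := Nl _ (leq_maxr n N); rewrite /= normE ltcR rdistC; exact: ltW.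
Qed.

End Completeness.

(** * Riesz representation and adjoints *)

Section Rates.
Variable R : realType.

Definition null_rate (d : nat -> R) := forall e, 0 < e -> exists n, d n < e.

Lemma null_rateZ d c : 0 <= c -> null_rate d -> null_rate (fun n => c * d n).
Proof.
move=> c0 d0 e e0; have c1 : 0 < c + 1 by lra.
have [n dn] := d0 _ (divr_gt0 e0 c1); exists n.
move: dn; rewrite ltr_pdivlMr// => dn.
have [d0'|d0'] := leP 0 (d n); first by nra.
by apply: le_lt_trans e0; nra.
Qed.

Lemma null_rate_le0 d a : null_rate d -> (forall n, a <= d n) -> a <= 0.
Proof.
move=> d0 ad; apply/ler_addgt0Pl => e e0; have [n dn] := d0 _ e0.
by rewrite addr0 ltW// (le_lt_trans (ad n)).
Qed.

Lemma null_rate_harmonic : null_rate (fun n => n.+1%:R^-1).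
Proof.
move=> e e0; have /cvgrPdist_lt/(_ _ e0) [n _ ne] := @cvg_harmonic R.
by exists n; have := ne n (leqnn n); rewrite /= sub0r normrN ger0_norm ?invr_ge0.
Qed.

Lemma null_rate_exp r : 0 <= r < 1 -> null_rate (fun n => r ^+ n).
Proof.
move=> /andP[r0 r1] e e0; have r1' : `|r| < 1 by rewrite ger0_norm.
have /cvgrPdist_lt/(_ _ e0) [n _ ne] := cvg_expr r1'.
by exists n; have := ne n (leqnn n); rewrite /= sub0r normrN ger0_norm// exprn_ge0.
Qed.

End Rates.

Section Riesz.
Variables (R : realType) (H : hilbertType R[i]).

(* The representing vector minimizes [|x|^2 - 2 f x]; the parallelogram law makes *)
(* minimizing sequences Cauchy.                                                   *)
Lemma riesz (f : H -> R) (k : R) :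
  (forall x y, f (x + y) = f x + f y) ->
  (forall t x, f (t%:C *: x) = t * f x) ->
  (forall x, `|f x| <= k * rnorm x) ->
  exists z, forall x, rdot x z = f x.
Proof.
move=> fD fZ fk; pose G x := rnorm x ^+ 2 - 2 * f x.
have G_ge x : - k ^+ 2 <= G x.
  by have := fk x; rewrite /G ler_norml => /andP[_]; have := sqr_ge0 (rnorm x - k); nra.
have hG : has_inf (range G).
  split; first by exists (G 0), 0.
  by exists (- k ^+ 2) => _ [x _ <-].
pose m := inf (range G); pose d n : R := n.+1%:R^-1.
have Gm x : m <= G x by apply: ge_inf; [exact: hG.2|exists x].
have d_gt0 n : 0 < d n by rewrite invr_gt0.
have /choice[u um] n : exists x, G x < m + d n ^+ 2.
  have [_ [x _ <-] xm] := inf_adherent (exprn_gt0 2 (d_gt0 n)) hG.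
  by exists x.
have [z uz] : exists z, forall n, rnorm (u n - z) <= 2 * d n.
  apply: cauchy_seq_cvg.
    by apply: null_rateZ => //; exact: null_rate_harmonic.
  move=> p q pq; rewrite -(@ler_pXn2r _ 2) ?nnegrE ?rnorm_ge0 ?mulr_ge0 ?ltW//.
  have dpq : d q <= d p by rewrite lef_pV2 ?posrE// ler_nat ltnS.
  have := parallelogram (u q) (u p); have := Gm (2^-1%:C *: (u q + u p)).
  have dpq2 : d q ^+ 2 <= d p ^+ 2 by rewrite ler_pXn2r ?nnegrE ?(ltW (d_gt0 _)).
  have -> : (2 * d p) ^+ 2 = 4 * d p ^+ 2 by ring.
  have := um p; have := um q; rewrite /G rnormZ fZ fD ger0_norm ?invr_ge0//.
  have -> : (2^-1 * rnorm (u q + u p)) ^+ 2 = rnorm (u q + u p) ^+ 2 / 4 by field.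
  lra.
exists z => h; apply/eqP; rewrite -subr_eq0 -normr_le0.
pose c := 2 * rnorm h + (1 + rnorm h ^+ 2).
apply: (@null_rate_le0 _ (fun n => c * d n)).
  apply: null_rateZ; last exact: null_rate_harmonic.
  by have := rnorm_ge0 h; have := sqr_ge0 (rnorm h); rewrite /c; lra.
move=> n.
have near_crit : `|rdot h (u n) - f h| <= (1 + rnorm h ^+ 2) * d n.
  have Gt t : - d n ^+ 2 <= - 2 * t * (rdot h (u n) - f h) + t ^+ 2 * rnorm h ^+ 2.
    have := Gm (u n - t%:C *: h); have := um n.
    have -> : u n - t%:C *: h = u n + (- t)%:C *: h by rewrite rmorphN /= scaleNr.
    rewrite /G fD fZ rmorphN /= scaleNr rnormB_sqr (rdotC (u n)); lra.
  have := d_gt0 n; have := Gt (d n); have := Gt (- d n).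
  rewrite sqrrN ler_norml => ? ? ?; have := sqr_ge0 (rnorm h) => ?.
  by apply/andP; split; rewrite -(ler_pM2r (d_gt0 n)); nra.
have -> : rdot h z - f h = - rdot h (u n - z) + (rdot h (u n) - f h).
  by rewrite rdotBr; ring.
apply: le_trans (ler_normD _ _) _; rewrite normrN.
have := rdot_le h (u n - z); have := uz n; have := rnorm_ge0 h.
move: near_crit; rewrite /c; nra.
Qed.

End Riesz.

Section OperatorBounds.
Variables (R : realType).
Implicit Types H K L : hilbertType R[i].

Definition opbound H K (f : H -> K) (k : R) := forall x, rnorm (f x) <= k * rnorm x.

Lemma bop_opbound H K (T : 'B(H, K)) : exists2 k, 0 < k & opbound T k.
Proof.
have /linear_boundedP/pinfty_ex_gt0[k k0 kP] := bop_bounded T.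
have kE : k = (complex.Re k)%:C by rewrite RRe_real ?gtr0_real.
exists (complex.Re k); first by rewrite -ltcR -kE.
by move=> x; rewrite -lecR rmorphM /= -kE -!normE.
Qed.

Lemma bop_of_opbound H K (f : H -> K) k :
  linear f -> opbound f k -> exists T : 'B(H, K), forall x, T x = f x.
Proof.
move=> flin fk.
pose F : {linear H -> K} := HB.pack f (GRing.isLinear.Build _ _ _ _ f flin).
suff bF : bounded_near F (nbhs (0 : H)) by exists (Bop bF).
apply/linear_boundedP; exists k%:C; split; first by rewrite complex_real.
move=> r kr x; apply: (@le_trans _ _ (k%:C * `|x|)).
  by rewrite !normE -rmorphM lecR; exact: fk.
by rewrite ler_wpM2r// ltW.
Qed.

Lemma opboundW H K (f : H -> K) k k' : k <= k' -> opbound f k -> opbound f k'.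
Proof.
by move=> kk' fk x; apply: le_trans (fk x) _; rewrite ler_wpM2r ?rnorm_ge0.
Qed.

Lemma opboundD H K (S T : 'B(H, K)) k k' :
  opbound S k -> opbound T k' -> opbound (S + T) (k + k').
Proof.
move=> Sk Tk x; rewrite mulrDl; apply: le_trans (ler_rnormD _ _) _.
exact: lerD.
Qed.

Lemma opboundN H K (T : 'B(H, K)) k : opbound T k -> opbound (- T) k.
Proof. by move=> Tk x; rewrite /= rnormN. Qed.

Lemma opboundM H K L (S : 'B(K, L)) (T : 'B(H, K)) k k' : 0 <= k ->
  opbound S k -> opbound T k' -> opbound (S ** T) (k * k').
Proof.
move=> k0 Sk Tk x; apply: le_trans (Sk _) _.
by rewrite -mulrA ler_wpM2l.
Qed.

End OperatorBounds.

Section Adjoint.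
Variables (R : realType).
Implicit Types H K L : hilbertType R[i].

Lemma opbound_rdot_adj H K (T : H -> K) (S : K -> H) k : 0 <= k -> opbound T k ->
  (forall x y, rdot (T x) y = rdot x (S y)) -> opbound S k.
Proof.
move=> k0 Tk TS y; have [->|/rnorm_gt0 Sy0] := eqVneq (S y) 0.
  by rewrite rnorm0 mulr_ge0 ?rnorm_ge0.
rewrite -(ler_pM2l Sy0) -expr2 rnorm_sqr -TS; apply: le_trans (ler_norm _) _.
apply: le_trans (rdot_le _ _) _.
by rewrite mulrA ler_wpM2r ?rnorm_ge0// mulrC.
Qed.

Lemma adj_exists H K (T : 'B(H, K)) :
  exists S : 'B(K, H), forall x y, rdot (T x) y = rdot x (S y).
Proof.
have [k k0 Tk] := bop_opbound T.
have /choice[S TS] y : exists z, forall x, rdot x z = rdot (T x) y.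
  apply: (@riesz _ _ _ (k * rnorm y)) => [x x'|t x|x].
  - by rewrite linearD rdotDl.
  - by rewrite linearZ /= rdotZl.
  - apply: le_trans (rdot_le _ _) _.
    by rewrite mulrAC ler_wpM2r ?rnorm_ge0.
have [||S' S'S] := @bop_of_opbound _ _ _ S k.
- move=> a y y'; apply: rdot_nondeg => x.
  by rewrite TS !rdotDr TS rdot_conjZ rdot_conjZ TS linearZ.
- by apply: opbound_rdot_adj (ltW k0) Tk _ => x y; rewrite TS.
- by exists S' => x y; rewrite S'S TS.
Qed.

Lemma adj_rdotP H K (T : 'B(H, K)) (S : 'B(K, H)) :
  (forall x y, rdot (T x) y = rdot x (S y)) -> adj T = S.
Proof.
move=> TS; apply: adj_unique => x y; apply: inner_rdot => //.
by rewrite -linearZ TS.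
Qed.

Lemma rdot_adjr H K (T : 'B(H, K)) x y : rdot x (adj T y) = rdot (T x) y.
Proof. by have [S TS] := adj_exists T; rewrite (adj_rdotP TS) TS. Qed.

Lemma rdot_adjl H K (T : 'B(H, K)) x y : rdot (adj T x) y = rdot x (T y).
Proof. by rewrite rdotC rdot_adjr rdotC. Qed.

Lemma adjK H K : cancel (@adj _ H K) (@adj _ K H).
Proof. by move=> T; apply: adj_rdotP => x y; rewrite rdot_adjl. Qed.

Lemma adjM H K L (S : 'B(K, L)) (T : 'B(H, K)) : adj (S ** T) = adj T ** adj S.
Proof. by apply: adj_rdotP => x y; rewrite /= !rdot_adjr. Qed.

Lemma adjD H K (S T : 'B(H, K)) : adj (S + T) = adj S + adj T.
Proof. by apply: adj_rdotP => x y; rewrite /= rdotDl rdotDr !rdot_adjr. Qed.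

Lemma adjN H K (T : 'B(H, K)) : adj (- T) = - adj T.
Proof. by apply: adj_rdotP => x y; rewrite /= rdotNl rdotNr rdot_adjr. Qed.

Lemma adj_id H : adj (bop_id H) = bop_id H.
Proof. exact: adj_rdotP. Qed.

Lemma opbound_adj H K (T : 'B(H, K)) k : 0 <= k -> opbound T k -> opbound (adj T) k.
Proof. by move=> k0 Tk; apply: opbound_rdot_adj k0 Tk _ => x y; rewrite rdot_adjr. Qed.

End Adjoint.

(** * Fixed points of contractions of operators *)

Section OperatorAlgebra.
Variable R : realType.
Implicit Types H K L M : hilbertType R[i].

Lemma compA H K L M (S : 'B(L, M)) (T : 'B(K, L)) (U : 'B(H, K)) :
  S ** (T ** U) = S ** T ** U.
Proof. exact: bop_eqP. Qed.

Lemma comp1l H K (T : 'B(H, K)) : bop_id K ** T = T.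
Proof. exact: bop_eqP. Qed.

Lemma comp1r H K (T : 'B(H, K)) : T ** bop_id H = T.
Proof. exact: bop_eqP. Qed.

Lemma compDl H K L (S T : 'B(K, L)) (U : 'B(H, K)) :
  (S + T) ** U = S ** U + T ** U.
Proof. exact: bop_eqP. Qed.

Lemma compDr H K L (U : 'B(K, L)) (S T : 'B(H, K)) :
  U ** (S + T) = U ** S + U ** T.
Proof. by apply: bop_eqP => x; rewrite /= linearD. Qed.

Lemma compNl H K L (S : 'B(K, L)) (U : 'B(H, K)) : (- S) ** U = - (S ** U).
Proof. exact: bop_eqP. Qed.

Lemma compNr H K L (S : 'B(K, L)) (U : 'B(H, K)) : S ** (- U) = - (S ** U).
Proof. by apply: bop_eqP => x; rewrite /= linearN. Qed.

Lemma comp0l H K L (U : 'B(H, K)) : (0 : 'B(K, L)) ** U = 0.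
Proof. exact: bop_eqP. Qed.

Lemma comp0r H K L (U : 'B(K, L)) : U ** (0 : 'B(H, K)) = 0.
Proof. by apply: bop_eqP => x; rewrite /= linear0. Qed.

Lemma bop_scale_continuous H K (a : R[i]) (T : 'B(H, K)) :
  continuous (a \*: T).
Proof. by move=> x; apply: cvgZl_tmp; exact: bop_continuous. Qed.

Definition bop_scale H K (a : R[i]) (T : 'B(H, K)) : 'B(H, K) :=
  bop_of_continuous (@bop_scale_continuous H K a T).

Lemma adj_scale H K (t : R) (T : 'B(H, K)) :
  adj (bop_scale t%:C T) = bop_scale t%:C (adj T).
Proof. by apply: adj_rdotP => x y; rewrite /= rdotZl rdotZr rdot_adjr. Qed.

Lemma inverse_of_unique H (T S S' : 'B(H)) :
  S ** T = bop_id H -> T ** S' = bop_id H -> S = S'.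
Proof. by move=> ST TS'; rewrite -[LHS]comp1r -TS' compA ST comp1l. Qed.

End OperatorAlgebra.

Section Contraction.
Variables (R : realType) (H K : hilbertType R[i]).

Lemma bop_contraction (F : 'B(H, K) -> 'B(H, K)) (rho r : R) :
  0 <= rho -> 0 <= r < 1 ->
  (forall T : 'B(H, K), opbound T rho -> opbound (F T) rho) ->
  (forall (S T : 'B(H, K)) d, 0 <= d -> opbound S rho -> opbound T rho ->
     opbound (S - T) d -> opbound (F S - F T) (r * d)) ->
  exists2 T : 'B(H, K), opbound T rho & F T = T.
Proof.
move=> rho0 r01 Fball Flip; have /andP[r0 r1] := r01.
pose T_ n := iter n F 0.
have Tball n : opbound (T_ n) rho.
  elim: n => [|n IHn]; last exact: Fball.
  by move=> x; rewrite /= rnorm0 mulr_ge0 ?rnorm_ge0.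
pose d n := r ^+ n * (2 * rho).
have d0 n : 0 <= d n by rewrite !mulr_ge0 ?exprn_ge0.
have dnull : null_rate d.
  move=> e e0; have [|n dn] := null_rateZ _ (null_rate_exp r01) (c := 2 * rho) e0.
    exact: mulr_ge0.
  by exists n; rewrite /d mulrC.
have Tcauchy n p : opbound (T_ (n + p)%N - T_ n) (d n).
  elim: n => [|n IHn]; last first.
    rewrite /d exprS -mulrA; apply: (Flip (T_ (n + p)%N) (T_ n)) => //; exact: d0.
  rewrite /d expr0 mul1r add0n mulr2n mulrDl mul1r.
  by apply: opboundD => //; apply: opboundN; exact: (Tball 0%N).
have /choice[L LP] x : exists l, forall n, rnorm (T_ n x - l) <= d n * rnorm x.
  apply: cauchy_seq_cvg.
    move=> e e0.
    have [n dn] := null_rateZ (rnorm_ge0 x) dnull e0.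
    by exists n; rewrite mulrC.
  by move=> n m nm; rewrite -(subnKC nm); exact: Tcauchy.
have Llim x y c : 0 <= c -> (forall n, rnorm (L x - y) <= c * d n) -> L x = y.
  move=> c0 xy; apply/eqP; rewrite -subr_eq0; apply/eqP/rnorm0_eq0/le_anti.
  by rewrite rnorm_ge0 andbT; apply: null_rate_le0 xy; exact: (null_rateZ c0 dnull).
have Lb : opbound L rho.
  move=> x; rewrite -subr_le0.
  apply: null_rate_le0 (null_rateZ (rnorm_ge0 x) dnull) _ => n.
  rewrite lerBlDr; apply: le_trans (_ : rnorm (T_ n x) + rnorm (T_ n x - L x) <= _).
    rewrite -{1}(subKr (T_ n x) (L x)).
    by apply: le_trans (ler_rnormD _ _) _; rewrite rnormN.
  by rewrite addrC lerD//; [rewrite mulrC; exact: LP|exact: Tball].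
have [|//|T TL] := @bop_of_opbound _ _ _ L rho.
  move=> a x y.
  apply: (Llim _ _ (rnorm (a *: x + y) + (complex.Re `|a| * rnorm x + rnorm y))) => [|n].
    by rewrite -rnormZc !addr_ge0 ?rnorm_ge0.
  apply: le_trans (rdist_triangle (T_ n (a *: x + y)) _ _) _.
  rewrite mulrDl lerD//; first by rewrite rdistC mulrC; exact: LP.
  rewrite linearP opprD addrACA -scalerBr mulrDl.
  apply: le_trans (ler_rnormD _ _) _; rewrite lerD//; last by rewrite mulrC; exact: LP.
  rewrite rnormZc -mulrA ler_wpM2l//; last by rewrite mulrC; exact: LP.
  by rewrite -ler0c RRe_real ?normr_real.
have Tb : opbound T rho by move=> x; rewrite TL; exact: Lb.
exists T => //; apply: bop_eqP => x; rewrite TL; apply/esym.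
apply: (Llim _ _ (2 * rnorm x)) => [|n]; first by rewrite mulr_ge0 ?rnorm_ge0.
have dS : d n.+1 <= d n by rewrite /d exprS -mulrA ler_piMl ?d0// ltW.
apply: le_trans (rdist_triangle (T_ n.+1 x) _ _) _.
have FTT : rnorm (T_ n.+1 x - F T x) <= d n.+1 * rnorm x.
  have -> : d n.+1 = r * d n by rewrite /d exprS -mulrA.
  apply: (Flip (T_ n) T) => // y.
  by rewrite /= TL; exact: LP.
have := LP x n.+1; rewrite rdistC; have := rnorm_ge0 x; nra.
Qed.

Lemma bop_shrink_eq0 (T : 'B(H, K)) (r : R) : 0 <= r < 1 ->
  (forall k, 0 <= k -> opbound T k -> opbound T (r * k)) -> T = 0.
Proof.
move=> r01 Tr; have /andP[r0 _] := r01; have [k k0 Tk] := bop_opbound T.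
have Tn n : opbound T (r ^+ n * k).
  elim: n => [|n IHn]; first by rewrite mul1r.
  by rewrite exprS -mulrA; apply: Tr => //; rewrite mulr_ge0 ?exprn_ge0// ltW.
apply: bop_eqP => x; apply/rnorm0_eq0/le_anti; rewrite rnorm_ge0 andbT.
have kx : 0 <= k * rnorm x by rewrite mulr_ge0 ?rnorm_ge0// ltW.
apply: null_rate_le0 (null_rateZ kx (null_rate_exp r01)) _ => n.
by rewrite mulrC mulrA; exact: Tn.
Qed.

End Contraction.

(** * Coercive operators *)

Section Coercive.
Variables (R : realType).
Implicit Types H K : hilbertType R[i].

Definition coercive H (S : 'B(H)) (c : R) :=
  forall x, c * rnorm x ^+ 2 <= rdot (S x) x.

Lemma coercive_step H (S : 'B(H)) (c : R) : 0 < c -> coercive S c ->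
  exists b r, [/\ 0 < b, 0 <= r < 1 & opbound (bop_id H - bop_scale b%:C S) r].
Proof.
move=> c0 Sc; have [k0 k00 Sk0] := bop_opbound S; pose k := k0 + c.
have k_gt0 : 0 < k by rewrite addr_gt0.
have Sk : opbound S k by apply: opboundW Sk0; rewrite lerDl ltW.
pose q := c / k; have q_gt0 : 0 < q by rewrite divr_gt0.
have q_le1 : q <= 1 by rewrite ler_pdivrMr// mul1r lerDr ltW.
have kq : k * q = c by rewrite /q mulrCA mulfV ?mulr1// gt_eqF.
exists (q / k), (1 - q ^+ 2 / 2); split; first by rewrite divr_gt0.
  by nra.
move=> x; rewrite -(@ler_pXn2r _ 2) ?nnegrE ?rnorm_ge0//; last first.
  by rewrite mulr_ge0 ?rnorm_ge0//; nra.
rewrite /= rnormB_sqr (rdotC x) [((1 - _) * _) ^+ 2]exprMn.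
have Skx : rnorm (S x) ^+ 2 <= k ^+ 2 * rnorm x ^+ 2.
  have kx : 0 <= k * rnorm x by rewrite mulr_ge0 ?rnorm_ge0// ltW.
  by rewrite -exprMn (@ler_pXn2r _ 2) ?nnegrE ?rnorm_ge0.
set b := q / k; have bk : b * k = q by rewrite /b divfK// gt_eqF.
have b_gt0 : 0 < b by rewrite divr_gt0.
have h1 : b * (c * rnorm x ^+ 2) <= b * rdot (S x) x by rewrite ler_pM2l.
have h2 : b ^+ 2 * rnorm (S x) ^+ 2 <= b ^+ 2 * (k ^+ 2 * rnorm x ^+ 2).
  by rewrite ler_wpM2l ?sqr_ge0.
have e1 : b * (c * rnorm x ^+ 2) = q ^+ 2 * rnorm x ^+ 2.
  by rewrite -kq -bk; ring.
have e2 : b ^+ 2 * (k ^+ 2 * rnorm x ^+ 2) = q ^+ 2 * rnorm x ^+ 2.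
  by rewrite -bk; ring.
have : 0 <= (q ^+ 2) ^+ 2 * rnorm x ^+ 2 by rewrite mulr_ge0 ?sqr_ge0.
move: h1 h2; rewrite e1 e2 mulr2n; set s := rnorm x ^+ 2; set p := q ^+ 2; nra.
Qed.

Lemma coercive_inj H (S : 'B(H)) (c : R) x : 0 < c -> coercive S c ->
  S x = 0 -> x = 0.
Proof.
move=> c0 Sc Sx; apply/rnorm0_eq0/eqP; rewrite -sqrf_eq0 eq_le sqr_ge0 andbT.
by have := Sc x; rewrite Sx rdot0l pmulr_rle0.
Qed.

(* The Neumann iteration [X <- 1 + (1 - b S) X] converges to [(b S)^-1]. *)
Lemma coercive_inverse H (S : 'B(H)) (c : R) : 0 < c -> coercive S c ->
  exists X, inverse_of S X.
Proof.
move=> c0 Sc; have [b [r [b0 r01 Sr]]] := coercive_step c0 Sc.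
have /andP[r0 r1] := r01; set N := bop_id H - bop_scale b%:C S in Sr.
have [||||X _ XN] := @bop_contraction _ _ _ (fun X => bop_id H + N ** X) (1 - r)^-1 r.
- by rewrite invr_ge0; lra.
- exact: r01.
- move=> T Tk; have -> : (1 - r)^-1 = 1 + r * (1 - r)^-1 by field; rewrite subr_eq0 gt_eqF.
  by apply: opboundD; [move=> x; rewrite mul1r|exact: opboundM].
- move=> X X' d d0 _ _ XX'; rewrite opprD addrACA subrr add0r -compNr -compDr.
  exact: opboundM.
have SX : S ** bop_scale b%:C X = bop_id H.
  apply: bop_eqP => x; have /(congr1 (fun T : 'B(H) => T x)) := XN.
  rewrite /= => /eqP; rewrite addrCA -subr_eq0 addrAC subrr add0r subr_eq0 => /eqP xE.
  by rewrite /= linearZ /= -xE.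
exists (bop_scale b%:C X); split => //; apply: bop_eqP => x.
apply/eqP; rewrite -subr_eq0; apply/eqP/(coercive_inj c0 Sc).
rewrite linearB; apply/eqP; rewrite subr_eq0; apply/eqP.
by have /(congr1 (fun T : 'B(H) => T (S x))) := SX.
Qed.

(* With [Y = S X - X S'] the hypothesis reads [S Y = - Y S'], so that             *)
(* [(1 + b S) Y = Y (1 - b S')], where [1 + b S] is bounded below by 1 and, for   *)
(* small [b], the norm of [1 - b S'] is less than 1.                              *)
Lemma coercive_intertwine H K (S : 'B(K)) (S' : 'B(H)) (X : 'B(H, K)) (c : R) :
  (forall x, 0 <= rdot (S x) x) -> 0 < c -> coercive S' c ->
  S ** S ** X = X ** (S' ** S') -> S ** X = X ** S'.
Proof.
move=> S0 c0 S'c SX; have [b [r [b0 r01 S'r]]] := coercive_step c0 S'c.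
pose Y := S ** X - X ** S'.
have SY x : S (Y x) = - Y (S' x).
  have /(congr1 (fun T : 'B(H, K) => T x)) /= := SX.
  by rewrite linearB /= => ->; rewrite opprB.
suff : Y = 0 by move/eqP; rewrite subr_eq0 => /eqP.
apply: (bop_shrink_eq0 r01) => k k0 Yk x.
have [->|/rnorm_gt0 Yx0] := eqVneq (Y x) 0.
  by rewrite rnorm0 !mulr_ge0 ?rnorm_ge0//; case/andP: r01.
have YE : Y x + b%:C *: S (Y x) = Y (x - b%:C *: S' x).
  by rewrite SY scalerN [RHS](linearB Y) (linearZ_LR Y).
apply: (@le_trans _ _ (rnorm (Y (x - b%:C *: S' x)))); last first.
  apply: le_trans (Yk _) _; rewrite -mulrA mulrCA ler_wpM2l//.
  exact: S'r.
rewrite -(ler_pM2r Yx0) -expr2 -YE.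
apply: le_trans (rdot_le _ _); apply: le_trans (ler_norm _).
by rewrite rdotDl rdotZl rnorm_sqr lerDl mulr_ge0// ltW.
Qed.

End Coercive.

(** * Positive square roots *)

Section SquareRoot.
Variables (R : realType).
Implicit Types H K : hilbertType R[i].

Lemma opboundZ H K (t k : R) (T : 'B(H, K)) : 0 <= t ->
  opbound T k -> opbound (bop_scale t%:C T) (t * k).
Proof.
by move=> t0 Tk x; rewrite /= rnormZ ger0_norm// -mulrA ler_wpM2l.
Qed.

Lemma rdot_iZC H (x y : H) : rdot ((0 +i* 1) *: x) y = - rdot x ((0 +i* 1) *: y).
Proof.
rewrite rdot_conjZ -rdotNl -scaleNr; congr (rdot (_ *: _) _).
by apply/eqP; rewrite eq_complex /= oppr0 opprK !eqxx.
Qed.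

Lemma positive_op_rdot_ge0 H (S : 'B(H)) : positive_op S -> forall x, 0 <= rdot (S x) x.
Proof. by move=> S0 x; have := S0 x; rewrite lecE => /andP[]. Qed.

Lemma positive_op_adj H (S : 'B(H)) : positive_op S -> adj S = S.
Proof.
move=> S0.
have q0 x : rdot (S ((0 +i* 1) *: x)) x = 0.
  rewrite linearZ rdot_iZ; have := S0 x.
  by rewrite lecE => /andP[/eqP -> _]; rewrite oppr0.
have qC x y : rdot (S ((0 +i* 1) *: x)) y = - rdot (S ((0 +i* 1) *: y)) x.
  have := q0 (x + y); rewrite scalerDr linearD rdotDl !rdotDr !q0 addr0 add0r.
  by move/eqP; rewrite addr_eq0 => /eqP.
apply: adj_rdotP => x y.
have -> : x = (0 +i* 1) *: ((0 +i* -1) *: x).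
  rewrite scalerA -[LHS]scale1r; congr (_ *: _); apply/eqP; rewrite eq_complex /=.
  by apply/andP; split; apply/eqP; ring.
by rewrite qC linearZ rdot_iZC opprK rdotC.
Qed.

Lemma positive_opP H (S : 'B(H)) :
  adj S = S -> (forall x, 0 <= rdot (S x) x) -> positive_op S.
Proof.
move=> Sadj S0 x; rewrite lecE S0 andbT.
have : rdot ((0 +i* 1) *: S x) x = - rdot ((0 +i* 1) *: S x) x.
  by rewrite {1}rdot_iZC -{1}Sadj rdot_adjl linearZ rdotC.
by rewrite rdot_iZ => ?; apply/eqP; rewrite [RHS]/=; lra.
Qed.

(* The iteration [Y <- (A + Y^2) / 2] for [1 - Y = (1 - A)^(1/2)], applied            *)
(* to [1 - A = b P] with [b] so small that [A] is a strict contraction.           *)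
Lemma bop_sqrt_exists H (P : 'B(H)) (c : R) : adj P = P -> 0 < c -> coercive P c ->
  exists S, positive_op S /\ S ** S = P.
Proof.
move=> Padj c0 Pc; have [b [r [b0 r01 Ar]]] := coercive_step c0 Pc.
have /andP[r0 r1] := r01; set A := bop_id H - bop_scale b%:C P in Ar.
have half0 : 0 <= 2^-1 :> R by rewrite invr_ge0.
pose F (Y : 'B(H)) := bop_scale (2^-1)%:C (A + Y ** Y).
have Flip (Y Z : 'B(H)) d : 0 <= d -> opbound Y r -> opbound Z r ->
    opbound (Y - Z) d -> opbound (F Y - F Z) (r * d).
  move=> d0 Yr Zr YZ.
  have -> : F Y - F Z = bop_scale (2^-1)%:C (Y ** (Y - Z) + (Y - Z) ** Z).
    apply: bop_eqP => x; rewrite /= -scalerBr; congr (_ *: _).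
    by rewrite linearB /= opprD addrACA subrr add0r addrA subrK.
  have -> : r * d = 2^-1 * (r * d + d * r) by field.
  by apply: opboundZ => //; apply: opboundD; exact: opboundM.
have Fball (Y : 'B(H)) : opbound Y r -> opbound (F Y) r.
  move=> Yr; apply: (@opboundW _ _ _ _ (2^-1 * (r + r * r))); first by nra.
  by apply: opboundZ => //; apply: opboundD => //; exact: opboundM.
have [Y Yr YF] := bop_contraction r0 r01 Fball Flip.
have Aadj : adj A = A by rewrite adjD adjN adj_scale adj_id Padj.
have Yadj : adj Y = Y.
  apply/eqP; rewrite -subr_eq0; apply/eqP; apply: (bop_shrink_eq0 r01) => k k0 Yk.
  have -> : adj Y - Y = F (adj Y) - F Y.
    by rewrite -[in LHS]YF /F adj_scale adjD adjM Aadj.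
  by apply: Flip => //; exact: opbound_adj.
pose s := Num.sqrt b^-1.
have s0 : 0 <= s by exact: sqrtr_ge0.
have ss : s * s = b^-1 by rewrite -expr2 sqr_sqrtr// invr_ge0 ltW.
exists (bop_scale s%:C (bop_id H - Y)); split.
  apply: positive_opP => [|x]; first by rewrite adj_scale adjD adjN adj_id Yadj.
  rewrite /= rdotZl mulr_ge0// rdotBl subr_ge0 -rnorm_sqr.
  apply: le_trans (ler_norm _) _; apply: le_trans (rdot_le _ _) _.
  rewrite expr2 ler_wpM2r ?rnorm_ge0//; apply: le_trans (Yr x) _.
  by rewrite ler_piMl ?rnorm_ge0// ltW.
have YE x : Y x + Y x = x - b%:C *: P x + Y (Y x).
  have YFx : Y x = (2^-1)%:C *: (x - b%:C *: P x + Y (Y x)) by rewrite -[in LHS]YF.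
  have e : 2^-1 + 2^-1 = 1 :> R by field.
  by rewrite {1 2}YFx -scalerDl -rmorphD e scale1r.
apply: bop_eqP => x; rewrite /= (linearZ_LR Y) -scalerBr scalerA -rmorphM ss (linearB Y) opprB.
rewrite (_ : x - Y x + (Y (Y x) - Y x) = b%:C *: P x).
  by rewrite scalerA -rmorphM mulVf ?gt_eqF// scale1r.
by rewrite addrACA -opprD YE opprD addrACA subrr addr0 subKr.
Qed.


Lemma positive_op_sqr_coercive H (S : 'B(H)) : positive_op S ->
  coercive (S ** S) 1 -> exists2 c, 0 < c & coercive S c.
Proof.
move=> S0 SS; have Sadj := positive_op_adj S0; have Sge0 := positive_op_rdot_ge0 S0.
have [k k0 Sk] := bop_opbound S; exists k^-1; first by rewrite invr_gt0.
move=> x; rewrite mulrC ler_pdivrMr//.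
have Sx1 : rnorm x ^+ 2 <= rnorm (S x) ^+ 2.
  by rewrite [leRHS]rnorm_sqr -{1}Sadj rdot_adjl rdotC; have := SS x; rewrite mul1r.
have SSx : rdot (S (S x)) (S x) <= k * rnorm (S x) ^+ 2.
  apply: le_trans (ler_norm _) _; apply: le_trans (rdot_le _ _) _.
  by rewrite expr2 mulrA ler_wpM2r ?rnorm_ge0.
have := Sge0 (x - k^-1%:C *: S x).
rewrite linearB (linearZ_LR S) rdotBl !rdotBr !rdotZl !rdotZr.
have -> : rdot (S (S x)) x = rnorm (S x) ^+ 2 by rewrite -{1}Sadj rdot_adjl rnorm_sqr.
rewrite -rnorm_sqr => h.
have e : k^-1 * rdot (S (S x)) (S x) <= rnorm (S x) ^+ 2.
  by rewrite mulrC ler_pdivrMr// mulrC.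
have k'0 : 0 < k^-1 by rewrite invr_gt0.
have {}h : k^-1 * rnorm (S x) ^+ 2 <= rdot (S x) x.
  by move: h; rewrite -(ler_pM2l k'0) in e; move: e; lra.
by apply: le_trans Sx1 _; rewrite -ler_pdivrMr// mulrC.
Qed.

Section Roots.
Variables (H : hilbertType R[i]) (P : 'B(H)).
Hypotheses (Padj : adj P = P) (P1 : coercive P 1).

Lemma bop_sqrtP : positive_op (bop_sqrt P) /\ bop_sqrt P ** bop_sqrt P = P.
Proof.
rewrite /bop_sqrt; case: xgetP => [S _ //|] noS.
by have [S /noS] := bop_sqrt_exists Padj ltr01 P1.
Qed.

Lemma adj_bop_sqrt : adj (bop_sqrt P) = bop_sqrt P.
Proof. by apply: positive_op_adj; case: bop_sqrtP. Qed.

Lemma coercive_bop_sqrt : exists2 c, 0 < c & coercive (bop_sqrt P) c.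
Proof.
by have [S0 SS] := bop_sqrtP; apply: positive_op_sqr_coercive; rewrite ?SS.
Qed.

Lemma bop_invsqrtP : inverse_of (bop_sqrt P) (bop_invsqrt P).
Proof.
rewrite /bop_invsqrt /bop_inv; case: xgetP => [X _ //|] noX.
have [c c0 Sc] := coercive_bop_sqrt.
by have [X /noX] := coercive_inverse c0 Sc.
Qed.

End Roots.

Lemma bop_sqrt_intertwine H K (P : 'B(K)) (Q : 'B(H)) (X : 'B(H, K)) :
  adj P = P -> coercive P 1 -> adj Q = Q -> coercive Q 1 ->
  P ** X = X ** Q -> bop_sqrt P ** X = X ** bop_sqrt Q.
Proof.
move=> Padj P1 Qadj Q1 PX.
have [S0 SS] := bop_sqrtP Padj P1; have [_ TT] := bop_sqrtP Qadj Q1.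
have [c c0 Tc] := coercive_bop_sqrt Qadj Q1.
by apply: (coercive_intertwine _ c0 Tc); rewrite ?SS ?TT//; exact: positive_op_rdot_ge0.
Qed.

End SquareRoot.

(** * Block decompositions *)

Section Inclusion.
Variables (R : realType) (H : hilbertType R[i]) (M : closedSubspace H).

Lemma incl_continuous : continuous (val : subspace_of M -> H).
Proof.
apply/linear_bounded_continuous/linear_boundedP; exists 1; split => // r r1 x.
by rewrite -sub_normE ler_peMl// ltW.
Qed.

Definition incl : 'B(M, H) := bop_of_continuous incl_continuous.

Lemma inclK : adj incl ** incl = bop_id M.
Proof.
by apply: bop_eqP => u; apply: rdot_nondeg => v; rewrite /= rdot_adjr.
Qed.

End Inclusion.

Section Blocks.
Variables (R : realType) (H : hilbertType R[i]) (M : closedSubspace H).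
Let N := orth M.

Lemma adj_incl_orth : adj (incl M) ** incl N = 0.
Proof.
apply: bop_eqP => v; apply: rdot_nondeg => u.
rewrite /= rdot_adjr rdot0r rdotC /rdot; have := valP v; rewrite inE => /(_ (val u)) ->//.
by have := valP u; rewrite inE.
Qed.

Lemma adj_orth_incl : adj (incl N) ** incl M = 0.
Proof.
rewrite -[LHS]adjK adjM adjK adj_incl_orth.
by apply: adj_rdotP => x y; rewrite rdot0l rdot0r.
Qed.

Lemma incl_orth_decomp :
  incl M ** adj (incl M) + incl N ** adj (incl N) = bop_id H.
Proof.
apply: bop_eqP => x /=.
pose y := adj (incl M) x.
have xN : x - val y \in cs_set N.
  rewrite inE; suff : orth_set (cs_set M) (x - val y) by [].
  move=> z Mz; have {}Mz : z \in cs_set M by rewrite inE.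
  pose w : M := SubspaceOf Mz.
  rewrite linearBl; apply/eqP; rewrite subr_eq0; apply/eqP.
  suff : '[x, z] = '[y, w] by [].
  by apply: inner_rdot; rewrite -?(linearZ_LR (adj (incl M))) rdot_adjl.
pose n : N := SubspaceOf xN.
have xE : x = incl M y + incl N n by rewrite [RHS]addrC [RHS]subrK.
suff -> : adj (incl N) x = n by [].
rewrite {1}xE linearD.
rewrite -[adj (incl N) (incl M y)]/((adj (incl N) ** incl M) y) adj_orth_incl add0r.
by rewrite -[LHS]/((adj (incl N) ** incl N) n) inclK.
Qed.

Lemma has_block_matrixP (T : 'B(H)) A B C D :
  has_block_matrix (M := M) T A B C D <->
  T ** incl M = incl M ** A + incl N ** C /\ T ** incl N = incl M ** B + incl N ** D.
Proof.
split=> [TP|[TM TN] u v].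
  split; apply: bop_eqP => u.
    by have := TP u 0; rewrite !linear0 !addr0.
  by have := TP 0 u; rewrite !linear0 !add0r.
have /(congr1 (fun S : 'B(M, H) => S u)) := TM.
have /(congr1 (fun S : 'B(N, H) => S v)) := TN.
rewrite /= linearD => -> ->.
by rewrite addrACA.
Qed.

Lemma block_matrix_exists (T : 'B(H)) : exists A B C D, has_block_matrix (M := M) T A B C D.
Proof.
exists (adj (incl M) ** T ** incl M), (adj (incl M) ** T ** incl N).
exists (adj (incl N) ** T ** incl M), (adj (incl N) ** T ** incl N).
by apply/has_block_matrixP; rewrite !compA -!compDl incl_orth_decomp comp1l.
Qed.

End Blocks.

Section Commutation.
Variables (R : realType) (H K : hilbertType R[i]).

Lemma coercive_1D (X : 'B(K, H)) : coercive (bop_id H + X ** adj X) 1.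
Proof.
by move=> x; rewrite mul1r rdotDl rnorm_sqr lerDl /= -rdot_adjr -rnorm_sqr sqr_ge0.
Qed.

Lemma adj_1D (X : 'B(K, H)) : adj (bop_id H + X ** adj X) = bop_id H + X ** adj X.
Proof. by rewrite adjD adj_id adjM adjK. Qed.

(* [A P] and [P A] are a left and a right inverse of [A]. *)
Lemma sandwich_commute (A P : 'B(H)) : A ** P ** A = bop_id H -> P ** A = A ** P.
Proof.
by move=> APA; apply/esym/(inverse_of_unique (T := A)); rewrite ?compA.
Qed.

Lemma polar_symmetry (A P : 'B(H)) : adj P = P -> coercive P 1 ->
  adj A = A -> A ** P ** A = bop_id H ->
  is_symmetry (A ** bop_sqrt P) /\ A ** bop_sqrt P ** bop_invsqrt P = A.
Proof.
move=> Padj P1 Aadj APA; have PA := sandwich_commute APA.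
have SA := bop_sqrt_intertwine Padj P1 Padj P1 PA.
have [_ SS] := bop_sqrtP Padj P1; have [_ SV] := bop_invsqrtP Padj P1.
have JJ : A ** bop_sqrt P ** (A ** bop_sqrt P) = bop_id H.
  by rewrite -compA [bop_sqrt P ** (_ ** _)]compA SA -compA SS -PA compA.
split; last by rewrite -compA SV comp1r.
by split; [rewrite adjM (adj_bop_sqrt Padj P1) Aadj SA|split].
Qed.

End Commutation.

Section Symmetry.
Variables (R : realType) (H : hilbertType R[i]) (M : closedSubspace H).
Let N := orth M.
Variables (J : 'B(H)) (symJ : is_symmetry J).
Variables (A : 'B(M)) (B : 'B(N, M)) (C : 'B(M, N)) (D : 'B(N)).
Hypothesis matJ : has_block_matrix J A B C D.

Lemma block_projl K (X : 'B(K, M)) (Y : 'B(K, N)) :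
  adj (incl M) ** (incl M ** X + incl N ** Y) = X.
Proof. by rewrite compDr !compA inclK adj_incl_orth comp1l comp0l addr0. Qed.

Lemma block_projr K (X : 'B(K, M)) (Y : 'B(K, N)) :
  adj (incl N) ** (incl M ** X + incl N ** Y) = Y.
Proof. by rewrite compDr !compA inclK adj_orth_incl comp1l comp0l add0r. Qed.

Lemma block_adj : [/\ adj A = A, adj C = B & adj D = D].
Proof.
have [JM JN] := (has_block_matrixP _ _ _ _ _).1 matJ; have [Jadj _] := symJ.
split.
- by rewrite -(block_projl A C) -JM !adjM adjK -Jadj compA.
- by rewrite -(block_projr A C) -JM !adjM adjK -Jadj -compA JN block_projl.
- by rewrite -(block_projr B D) -JN !adjM adjK -Jadj compA.
Qed.

Lemma block_sqr :
  [/\ A ** A + B ** C = bop_id M, A ** B + B ** D = 0 & C ** B + D ** D = bop_id N].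
Proof.
have [JM JN] := (has_block_matrixP _ _ _ _ _).1 matJ; have [_ [JJ _]] := symJ.
have e K (X : 'B(K, M)) (Y : 'B(K, N)) : J ** (incl M ** X + incl N ** Y) =
    incl M ** (A ** X + B ** Y) + incl N ** (C ** X + D ** Y).
  by rewrite compDr !compA JM JN !compDl !compDr !compA addrACA.
have eM : incl M = incl M ** (A ** A + B ** C) + incl N ** (C ** A + D ** C).
  by rewrite -e -JM compA JJ comp1l.
have eN : incl N = incl M ** (A ** B + B ** D) + incl N ** (C ** B + D ** D).
  by rewrite -e -JN compA JJ comp1l.
split.
- by rewrite -[RHS]inclK [in X in _ = _ ** X]eM block_projl.
- by rewrite -[RHS]adj_incl_orth [in X in _ = _ ** X]eN block_projl.
- by rewrite -[RHS]inclK [in X in _ = _ ** X]eN block_projr.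
Qed.

Lemma J_projectionP (E : 'B(H)) (E1 : 'B(N, M)) : is_idempotent E ->
  has_block_matrix E (bop_id M) E1 0 0 -> J_projection J E <-> B = A ** E1.
Proof.
move=> idemE /has_block_matrixP[]; rewrite !comp0r !addr0 comp1r => EM EN.
have [JM JN] := (has_block_matrixP _ _ _ _ _).1 matJ; have [Jadj [JJ _]] := symJ.
split=> [[_ EJ]|BA].
  have JE : J ** E = adj E ** J by rewrite {1}EJ !compA JJ comp1l.
  rewrite -(block_projl B D) -JN -[in LHS]EM adjM -compA [adj E ** _]compA -JE.
  by rewrite -compA EN [J ** _]compA JM compDl -!compA block_projl.
have [Aadj CB _] := block_adj.
pose G := adj (incl M) + E1 ** adj (incl N).
have EG : E = incl M ** G.
  by rewrite -[LHS]comp1r -(incl_orth_decomp M) compDr !compA EM EN compDr compA.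
have JG : J ** incl M = adj G ** A.
  have CE : C = adj E1 ** A by rewrite -[C]adjK CB BA adjM Aadj.
  by rewrite JM CE adjD adjM !adjK compDl compA.
have JE : adj (J ** E) = J ** E.
  by rewrite EG compA JG !adjM adjK Aadj compA.
have {}JE : adj E ** J = J ** E by rewrite -JE adjM -Jadj.
by split=> //; rewrite -compA JE compA JJ comp1l.
Qed.

End Symmetry.

Theorem lemma13 (R : realType) (H : hilbertType R[i])
    (E : 'B(H)) (idemE : is_idempotent E)
    (E1 : 'B(orth (ran idemE), ran idemE))
    (matE : has_block_matrix E (bop_id (ran idemE)) E1 0 0)
    (J : 'B(H)) (symJ : is_symmetry J) :
  J_projection J E <->
  exists (J1 : 'B(ran idemE)) (J2 : 'B(orth (ran idemE))),
    [/\ is_symmetry J1,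
        is_symmetry J2,
        J1 ** E1 + E1 ** J2 = 0 &
        has_block_matrix J
          (J1 ** bop_invsqrt (bop_id (ran idemE) + E1 ** adj E1))
          (J1 ** bop_invsqrt (bop_id (ran idemE) + E1 ** adj E1) ** E1)
          (adj E1 ** bop_invsqrt (bop_id (ran idemE) + E1 ** adj E1) ** J1)
          (J2 ** bop_invsqrt (bop_id (orth (ran idemE)) + adj E1 ** E1))].
Proof.
split=> [JE|[J1 [J2 [_ _ _ matJ]]]]; last exact/(J_projectionP symJ matJ idemE matE).
set M := ran idemE in E1 matE *.
have [A [B [C [D matJ]]]] := block_matrix_exists M J.
have BA := (J_projectionP symJ matJ idemE matE).1 JE.
have [Aadj CB Dadj] := block_adj symJ matJ.
have [AA AB DD] := block_sqr symJ matJ.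
have CA : C = adj E1 ** A by rewrite -[C]adjK CB BA adjM Aadj.
set P := bop_id M + E1 ** adj E1; set Q := bop_id (orth M) + adj E1 ** E1.
have Padj : adj P = P by exact: adj_1D.
have P1 : coercive P 1 by exact: coercive_1D.
have QE : Q = bop_id (orth M) + adj E1 ** adj (adj E1) by rewrite adjK.
have Qadj : adj Q = Q by rewrite QE adj_1D.
have Q1 : coercive Q 1 by rewrite QE; exact: coercive_1D.
have APA : A ** P ** A = bop_id M.
  by rewrite -AA BA CA compDr compDl comp1r !compA.
have AE : A ** E1 = - (E1 ** D).
  apply/eqP; rewrite -addr_eq0; apply/eqP.
  have AS : A ** (A ** E1 + E1 ** D) = 0 by rewrite compDr [A ** (E1 ** D)]compA -BA.
  by rewrite -[LHS]comp1l -APA -(compA (A ** P)) AS comp0r.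
have EA : adj E1 ** A = - (D ** adj E1).
  by rewrite -[LHS]adjK adjM adjK Aadj AE adjN adjM Dadj.
have DQD : D ** Q ** D = bop_id (orth M).
  by rewrite -DD CA BA EA compDr compDl comp1r addrC AE compNl compNr opprK !compA.
have [symJ1 J1V] := polar_symmetry Padj P1 Aadj APA.
have [symJ2 J2V] := polar_symmetry Qadj Q1 Dadj DQD.
exists (A ** bop_sqrt P), (D ** bop_sqrt Q); split => //.
  have PE : P ** E1 = E1 ** Q by rewrite compDl compDr comp1l comp1r compA.
  rewrite -compA (bop_sqrt_intertwine Padj P1 Qadj Q1 PE) !compA -compDl AE addNr.
  exact: comp0l.
have PA := sandwich_commute APA.
have SA := bop_sqrt_intertwine Padj P1 Padj P1 PA.
have [VS _] := bop_invsqrtP Padj P1.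
rewrite J1V J2V -BA -SA -(compA (adj E1)) [bop_invsqrt P ** _]compA VS comp1l -CA.
exact: matJ.
Qed.
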